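(* Let $A:\mathcal{H}_1\to\mathcal{H}_2$ be a nonzero bounded linear operator between real Hilbert spaces. The following statements are equivalent: (i) $\operatorname{im}A$ is closed; (ii) $\operatorname{im}A=(\ker A^* )^\perp$; (iii) $|A|>0$; (iv) $\operatorname{im}A^*$ is closed; (v) $\operatorname{im}A^*=(\ker A)^\perp$; (vi) $|A^*|>0$; (vii) $\operatorname{im}AA^*$ is closed; (viii) $\operatorname{im}AA^*=(\ker AA^* )^\perp$; (ix) $|AA^*|>0$; (x) $\operatorname{im}A^*A$ is closed; (xi) $\operatorname{im}A^*A=(\ker A^*A)^\perp$; (xii) $|A^*A|>0$. Moreover, if any of the conditions (i)-(xii) holds, then $\operatorname{im}AA^*=\operatorname{im}A$ and $\operatorname{im}A^*A=\operatorname{im}A^*$. Furthermore, if any of the conditions (i)-(xii) holds, then $A^\#$ has a bounded inverse and $$|A|=|A^*|=\sqrt{|AA^*|}=\sqrt{|A^*A|}=\frac{1}{\|(A^\#)^{-1}\|}.$$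
   Context: $A^*$ is the adjoint of $A$; $\ker$ and $\operatorname{im}$ denote kernel and image; $V^\perp$ is the orthogonal complement. For a nonzero bounded linear operator $B$ between Hilbert spaces, $|B|:=\inf\{\|Bx\| : x\in(\ker B)^\perp,\ \|x\|=1\}$. The operator $A^\#:(\ker A)^\perp\to\operatorname{im}A$ is the restriction $A^\#:=A|_{(\ker A)^\perp}$, which is a bijection. *)

(* Defs.v *)
From HB Require Import structures.
From mathcomp Require Import all_boot all_order all_algebra.
From mathcomp Require Import all_classical all_reals all_analysis.

Set Implicit Arguments.
Unset Strict Implicit.
Unset Printing Implicit Defensive.

Import Order.TTheory GRing.Theory Num.Theory.
Import numFieldNormedType.Exports.

Local Open Scope classical_set_scope.
Local Open Scope ring_scope.

HB.mixin Record CompleteNormedModule_isHilbert (R : realType) V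
    of CompleteNormedModule R V := {
  inner : {dot V for idfun};
  inner_norm : forall x : V, inner x x = `|x| ^+ 2
}.

(* Real Hilbert spaces: complete normed modules whose norm, and hence whose
   topology, is the one induced by the inner product. *)
#[short(type="hilbertType")]
HB.structure Definition Hilbert (R : realType) :=
  {V of CompleteNormedModule R V & CompleteNormedModule_isHilbert R V}.

Definition orthc (R : realType) (H : hilbertType R) (S : set H) : set H :=
  [set x | forall y, S y -> inner x y = 0].

Section Operators.
Context (R : realType) (H1 H2 : hilbertType R).
Implicit Types (S : set H1) (B : H1 -> H2).

Definition bounded_on S B : Prop :=
  exists M : R, forall x, S x -> `|B x| <= M * `|x|.

(* Operator norm of the restriction of B to S. As a supremum in R it is
   meaningful when bounded_on S B holds. *)
Definition opnorm_on S B : R :=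
  sup [set `|B x| | x in [set x | S x /\ `|x| <= 1]].

Definition ker B : set H1 := [set x | B x = 0].

Definition lower_modulus B : R :=
  inf [set `|B x| | x in [set x | orthc (ker B) x /\ `|x| = 1]].

(* For bounded linear B the set below is a singleton for every y (Riesz), so
   the default value 0 is never taken. *)
Definition adjoint B : H2 -> H1 :=
  fun y => xget 0 [set z | forall x, inner (B x) y = inner x z].

(* Inverse of the restriction of B to the orthogonal complement of its kernel.
   For bounded linear B this restriction is a bijection onto range B; outside
   of range B the function is irrelevant (it is 0 there). *)
Definition sharp_inv B : H2 -> H1 := 'pinv_(fun=> 0) (orthc (ker B)) B.

End Operators.

(* Main.v *)
Require Import Defs.
From HB Require Import structures.
From mathcomp Require Import all_boot all_order all_algebra.
From mathcomp Require Import all_classical all_reals all_analysis.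
From mathcomp Require Import ring lra.

(** Everything rests on one symmetric notion, a pair of bounded operators
    adjoint to each other.  If (B, C) is such a pair then so is (C, B), and
    C B is paired with itself; hence a fact proved once for all pairs applies
    to A, A', A A' and A' A at the same time.

    For a pair (B, C), being bounded below by c means c |x| <= |B x| on
    (ker B)^perp, and |B| is the largest such c ([le_lower_modulus]).  The
    equivalences come from a cycle:
    - if im B is closed then C is bounded below
      ([closed_range_bounded_below]).  The functionals <-, y> with y in im B
      and |C y| <= 1 are pointwise bounded, since <B x, y> = <x, C y>, so they
      are uniformly bounded by the Banach-Steinhaus theorem; this replaces
      the open mapping theorem;
    - if C is bounded below then im C is closed, by completeness
      ([bounded_below_closed_range]).
    Applied to (B, C) and then to (C, B), this makes closedness of im B,
    closedness of im C, |B| > 0 and |C| > 0 equivalent.  Since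
    im B is dense in (ker C)^perp, closedness also amounts to
    im B = (ker C)^perp ([closed_rangeE]).  The products join the list because
    ker (C B) = ker B ([ker_adjoint_comp], [comp_closed_range]).

    The equalities between moduli are comparisons of lower bounds.  Writing an
    element of (ker C)^perp as B x with x in (ker B)^perp, the inequality
    |B x|^2 = <x, C B x> <= |x| |C B x| turns a lower bound c of B into the
    same lower bound for C ([bounded_below_adjoint]), and a lower bound c of
    C B into the lower bound sqrt c for C, hence for B
    ([bounded_below_sqrt]).

    The Hilbert space facts used along the way are the projection theorem, the
    double orthogonal complement and the Riesz representation theorem; the
    last one provides the adjoint. *)

Import Order.TTheory GRing.Theory Num.Theory.
Import numFieldNormedType.Exports.

Local Open Scope classical_set_scope.
Local Open Scope ring_scope.

(** * Geometry of real Hilbert spaces *)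

Section InnerProduct.
Set Implicit Arguments.
Unset Strict Implicit.
Context {R : realType} {H : hilbertType R}.
Implicit Types (x y z : H) (S : set H).

Lemma innerC x y : inner x y = inner y x.
Proof. by rewrite hermC/= expr0 mul1r. Qed.

Lemma innerDr x y z : inner x (y + z) = inner x y + inner x z.
Proof. exact: linearDr. Qed.

Lemma innerZr (a : R) x y : inner x (a *: y) = a * inner x y.
Proof. exact: linearZr_LR. Qed.

Lemma inner0r x : inner x 0 = 0.
Proof. by rewrite -[0 in LHS](scale0r x) innerZr mul0r. Qed.

Lemma innerNr x y : inner x (- y) = - inner x y.
Proof. by rewrite -scaleN1r innerZr mulN1r. Qed.

Lemma innerBr x y z : inner x (y - z) = inner x y - inner x z.
Proof. by rewrite innerDr innerNr. Qed.

Lemma innerDl x y z : inner (x + y) z = inner x z + inner y z.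
Proof. by rewrite !(innerC _ z) innerDr. Qed.

Lemma innerZl (a : R) x y : inner (a *: x) y = a * inner x y.
Proof. by rewrite !(innerC _ y) innerZr. Qed.

Lemma inner0l x : inner 0 x = 0.
Proof. by rewrite innerC inner0r. Qed.

Lemma innerBl x y z : inner (x - y) z = inner x z - inner y z.
Proof. by rewrite !(innerC _ z) innerBr. Qed.

Lemma inner_self_eq0 x : inner x x = 0 -> x = 0.
Proof. by rewrite inner_norm => /eqP; rewrite sqrf_eq0 normr_eq0 => /eqP. Qed.

Lemma inner_inj x y : (forall z, inner z x = inner z y) -> x = y.
Proof.
move=> xy; apply/eqP; rewrite -subr_eq0; apply/eqP/inner_self_eq0.
by rewrite innerBr xy subrr.
Qed.

Lemma sqr_norm_subZ x y (t : R) :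
  `|x - t *: y| ^+ 2 = `|x| ^+ 2 - 2 * t * inner x y + t ^+ 2 * `|y| ^+ 2.
Proof.
rewrite -!inner_norm !innerBr !innerBl !innerZr !innerZl (innerC y x).
by ring.
Qed.

Lemma parallelogram x y :
  `|x + y| ^+ 2 + `|x - y| ^+ 2 = 2 * `|x| ^+ 2 + 2 * `|y| ^+ 2.
Proof.
by rewrite -!inner_norm !innerBr !innerBl !innerDr !innerDl (innerC y x); ring.
Qed.

(** Expand the square of | |y| x - |x| y |. *)
Lemma cauchy_schwarz x y : `|inner x y| <= `|x| * `|y|.
Proof.
have CS : forall u v : H, inner u v <= `|u| * `|v|.
  move=> u v; have [->|v0] := eqVneq v 0; first by rewrite inner0r normr0 mulr0.
  have [->|u0] := eqVneq u 0; first by rewrite inner0l normr0 mul0r.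
  have uv0 : 0 < `|u| * `|v| by rewrite mulr_gt0// normr_gt0.
  have : 0 <= `| `|v| *: u - `|u| *: v| ^+ 2 by exact: sqr_ge0.
  rewrite sqr_norm_subZ innerZl normrZ normr_id => h.
  rewrite -(ler_pM2l uv0); nra.
rewrite ler_norml CS andbT lerNl -innerNr -(normrN y); exact: CS.
Qed.

Definition subspace S :=
  S 0 /\ forall (a : R) x y, S x -> S y -> S (a *: x + y).

Lemma subspaceZ S (a : R) x : subspace S -> S x -> S (a *: x).
Proof. by move=> [S0 lin] Sx; rewrite -[a *: x]addr0; exact: lin. Qed.

Lemma subspaceB S x y : subspace S -> S x -> S y -> S (x - y).
Proof. by move=> [_ lin] Sx Sy; rewrite addrC -scaleN1r; exact: lin. Qed.

Lemma subspace_orthc S : subspace (orthc S).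
Proof.
split=> [y _|a x y Sx Sy z Sz]; first exact: inner0l.
by rewrite innerDl innerZl Sx// Sy// mulr0 addr0.
Qed.

Lemma closed_approxP S :
  closed S <->
  forall x, (forall e : R, 0 < e -> exists2 y, S y & `|x - y| < e) -> S x.
Proof.
split=> [clS x h|h].
  apply: clS => U /nbhs_normP[e /= e0 eU].
  by have [y Sy xy] := h e e0; exists y; split=> //; apply: eU.
move=> x clx; apply: h => e e0.
have /clx[y [Sy xy]] : nbhs x (ball_ Num.norm x e).
  by apply/nbhs_normP; exists e.
by exists y.
Qed.

Lemma closed_orthc S : closed (orthc S).
Proof.
apply/closed_approxP => x h y Sy; apply/eqP; rewrite -normr_le0.
apply/ler_addgt0Pr => e e0; rewrite add0r.
have y1 : 0 < `|y| + 1 by rewrite ltr_wpDl.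
have [z Sz xz] := h _ (divr_gt0 e0 y1).
have -> : inner x y = inner (x - z) y by rewrite innerBl Sz// subr0.
apply: (le_trans (cauchy_schwarz _ _)).
rewrite ltr_pdivlMr// in xz; apply: le_trans (ltW xz).
by rewrite ler_wpM2l// lerDl.
Qed.

Lemma orthc_sub_eq0 S x : S x -> orthc S x -> x = 0.
Proof. by move=> Sx /(_ _ Sx) /inner_self_eq0. Qed.

(** Completeness in the form of Cantor's intersection theorem: P e is thought
    of as the set of e-approximate solutions of a problem.  It produces both
    the closest point of a subspace and the preimage of a limit of values of
    an operator. *)
Lemma shrinking_sets_cvg (P : R -> set H) :
  (forall d e x, d <= e -> P d x -> P e x) ->
  (forall e, 0 < e -> exists x, P e x) ->
  (forall e, 0 < e ->
    exists2 d, 0 < d & forall x y, P d x -> P d y -> `|x - y| < e) ->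
  exists l, forall e, 0 < e -> exists2 x, P e x & `|x - l| < e.
Proof.
move=> Ple Pex Pdiam.
have /choice[u uP] : forall n : nat, exists x, P n.+1%:R^-1 x.
  by move=> n; apply: Pex; rewrite invr_gt0.
have uP' (e : R) : 0 < e -> exists N, forall n, (N <= n)%N -> P e (u n).
  move=> e0; exists (Num.truncn e^-1) => n Nn; apply: Ple (uP n).
  rewrite invf_ple ?posrE//; apply/ltW.
  by rewrite (lt_le_trans (truncnS_gt _))// ler_nat.
have cu : cauchy (u @ \oo).
  apply/cauchy_ballP => e e0; have [d d0 Pd] := Pdiam e e0.
  have [N NP] := uP' d d0.
  exists ([set x | P d x], [set x | P d x]) => /=.
    by split; exists N => // n /= /NP.
  by move=> [x y] /= [Px Py]; rewrite -ball_normE; exact: Pd.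
have /cauchy_cvgP/cvg_ex[l ul] := cu.
exists l => e e0.
have [N1 N1P] := uP' e e0.
have /cvgrPdist_lt/(_ e e0)[N2 _ N2P] := ul.
exists (u (maxn N1 N2)); first exact/N1P/leq_maxl.
by rewrite distrC; apply: N2P; exact: leq_maxr.
Qed.

Lemma closest_point_exists S x : subspace S -> closed S ->
  exists2 p, S p & forall s, S s -> `|x - p| <= `|x - s|.
Proof.
move=> subS clS; have [S0 Slin] := subS.
pose D := [set `|x - s| | s in S]; pose d := inf D.
have infD : has_inf D.
  by split; [exists `|x - 0|; exists 0 | exists 0 => _ [s _ <-]].
have d0 : 0 <= d by apply: lb_le_inf infD.1 _ => _ [s _ <-].
have dle s : S s -> d <= `|x - s|.
  by move=> Ss; apply: ge_inf infD.2 _ _; exists s.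
have [] := @shrinking_sets_cvg (fun e s => S s /\ `|x - s| < d + e).
- move=> e e' s ee' [Ss xs]; split=> //.
  by apply: (lt_le_trans xs); rewrite lerD2l.
- move=> e e0; have [_ [s Ss <-] xs] := inf_adherent e0 infD.
  by exists s.
- move=> e e0.
  (* If s and t are at distance less than d + d' from x, the parallelogram law
     gives |s - t|^2 < 4 (d + d')^2 - 4 d^2 = 8 d d' + 4 d'^2, because their
     midpoint is at distance at least d; d' makes this at most e^2. *)
  pose d' := Num.min 1 (e ^+ 2 / (8 * d + 5)).
  have k0 : 0 < 8 * d + 5 by nra.
  have d'0 : 0 < d' by rewrite lt_min ltr01 divr_gt0// exprn_gt0.
  have d'1 : d' <= 1 by rewrite ge_min lexx.
  have d'e : d' * (8 * d + 5) <= e ^+ 2.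
    by rewrite -ler_pdivlMr// ge_min lexx orbT.
  exists d' => // s t [Ss xs] [St xt].
  have Sm : S (2^-1 *: s + 2^-1 *: t).
    by apply: Slin => //; exact: (subspaceZ _ subS St).
  have := parallelogram (x - s) (x - t).
  have -> : x - s - (x - t) = t - s by rewrite opprB addrC addrA subrK.
  have -> : x - s + (x - t) = 2 *: (x - (2^-1 *: s + 2^-1 *: t)).
    rewrite scalerBr scalerDr !scalerA divff// !scale1r scaler_nat mulr2n opprD.
    by rewrite addrACA.
  rewrite normrZ (@ger0_norm _ 2)// => par.
  have dm := dle _ Sm; have ds := dle _ Ss; have dt := dle _ St.
  rewrite distrC -(@ltr_pXn2r _ 2)// ?nnegrE//; last exact: ltW.
  have h1 : `|x - s| ^+ 2 < (d + d') ^+ 2.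
    by rewrite ltr_pXn2r// ?nnegrE// ltW// ltr_wpDl.
  have h2 : `|x - t| ^+ 2 < (d + d') ^+ 2.
    by rewrite ltr_pXn2r// ?nnegrE// ltW// ltr_wpDl.
  have h3 : d ^+ 2 <= `|x - (2^-1 *: s + 2^-1 *: t)| ^+ 2.
    by rewrite ler_pXn2r// nnegrE.
  rewrite exprMn in par; nra.
move=> p pP.
have Sp : S p.
  move/closed_approxP: clS; apply=> e e0.
  by have [s [Ss _] sp] := pP e e0; exists s => //; rewrite distrC.
exists p => // s Ss; apply: le_trans (dle _ Ss).
apply/ler_addgt0Pr => e e0.
have e2 : 0 < e / 2 by rewrite divr_gt0.
have [t [St xt] tp] := pP _ e2.
have := ler_distD t x p; lra.
Qed.

(** The error x - p at a closest point p is orthogonal to every s of S: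
    otherwise p + t s, with t the coefficient of the projection of x - p on s,
    would be closer to x. *)
Lemma orthogonal_projection S x : subspace S -> closed S ->
  exists2 p, S p & orthc S (x - p).
Proof.
move=> subS clS; have [p Sp pmin] := closest_point_exists x subS clS.
exists p => // s Ss; have [->|s0] := eqVneq s 0; first exact: inner0r.
have ns : 0 < `|s| ^+ 2 by rewrite exprn_gt0// normr_gt0.
set b := inner _ _; pose t := b / `|s| ^+ 2.
have : `|x - p| ^+ 2 <= `|x - p - t *: s| ^+ 2.
  rewrite ler_pXn2r// ?nnegrE//.
  have -> : x - p - t *: s = x - (t *: s + p) by rewrite opprD addrA addrAC.
  by apply: pmin; apply: subS.2.
rewrite sqr_norm_subZ -/b.
have -> : - (2 * t * b) = - (2 * (b ^+ 2 / `|s| ^+ 2)).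
  by rewrite /t; field; rewrite normr_eq0.
have -> : t ^+ 2 * `|s| ^+ 2 = b ^+ 2 / `|s| ^+ 2.
  by rewrite /t; field; rewrite normr_eq0.
move=> h; have : b ^+ 2 / `|s| ^+ 2 <= 0 by lra.
rewrite pmulr_lle0 ?invr_gt0// => b0.
by apply/eqP; rewrite -sqrf_eq0 eq_le b0 sqr_ge0.
Qed.

Lemma orthcK S : subspace S -> closed S -> orthc (orthc S) = S.
Proof.
move=> subS clS; apply/seteqP; split=> x; last first.
  by move=> Sx y; rewrite innerC; apply.
move=> x2; have [p Sp xp] := orthogonal_projection x subS clS.
suff -> : x = p by [].
apply/eqP; rewrite -subr_eq0; apply/eqP/inner_self_eq0.
by rewrite innerBl x2// innerC xp// subrr.
Qed.

(** A vector w orthogonal to ker f and outside it spans a complement of ker f,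
    so f is a multiple of the inner product with w. *)
Lemma riesz_representation (f : H -> R) (M : R) :
  (forall (a : R) x y, f (a *: x + y) = a * f x + f y) ->
  (forall x, `|f x| <= M * `|x|) ->
  exists z, forall x, f x = inner x z.
Proof.
move=> flin fM.
have [f0|] := pselect (forall x, f x = 0).
  by exists 0 => x; rewrite f0 inner0r.
move=> /existsNP[x0 /eqP fx0].
have f00 : f 0 = 0 by have := flin 1 0 0; rewrite scale1r addr0 mul1r; lra.
have fN x y : f (x - y) = f x - f y.
  by rewrite addrC -scaleN1r flin mulN1r addrC.
have sK : subspace [set x | f x = 0].
  by split=> //= a x y fx fy; rewrite flin fx fy mulr0 addr0.
have cK : closed [set x | f x = 0].
  apply/closed_approxP => x h /=; apply/eqP; rewrite -normr_le0.
  apply/ler_addgt0Pr => e e0; rewrite add0r.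
  have M1 : 0 < `|M| + 1 by rewrite ltr_wpDl.
  have [y /= fy xy] := h _ (divr_gt0 e0 M1).
  rewrite -(subr0 (f x)) -fy -fN; apply: (le_trans (fM _)).
  rewrite ltr_pdivlMr// mulrC in xy; apply: le_trans (ltW xy).
  by rewrite ler_wpM2r// (le_trans (ler_norm _))// lerDl.
have [p /= fp wK] := orthogonal_projection x0 sK cK.
set w := x0 - p in wK.
have fw : f w != 0 by rewrite fN fp subr0.
have w0 : w != 0 by apply: contra_neq fw => ->.
have ww : inner w w != 0 by apply: contra_neq w0 => /inner_self_eq0.
exists ((f w / inner w w) *: w) => x.
have /wK : [set x | f x = 0] (x - (f x / f w) *: w).
  by rewrite /= addrC -scaleNr flin mulNr divfK// addNr.
rewrite innerBr innerZr => /subr0_eq; rewrite innerC innerZr => ->.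
by field; rewrite fw.
Qed.

End InnerProduct.

(** * Adjoint pairs of bounded operators *)

Section AdjointPair.
Set Implicit Arguments.
Unset Strict Implicit.
Context {R : realType}.
Implicit Types (H : hilbertType R).

(** The adjunction identity alone makes both maps linear, and boundedness
    passes from B to C; so this is a symmetric relation between B and C and
    covers linear maps as well as the bare functions given by [adjoint]. *)
Record adjoint_pair H1 H2 (B : H1 -> H2) (C : H2 -> H1) : Prop := AdjointPair {
  adjoint_pair_bounded : bounded_on setT B;
  adjoint_pairE : forall x y, inner (B x) y = inner x (C y) }.

Definition bounded_below H1 H2 (B : H1 -> H2) (c : R) : Prop :=
  forall x, orthc (ker B) x -> c * `|x| <= `|B x|.

Lemma bounded_posP H1 H2 (B : H1 -> H2) :
  bounded_on setT B -> exists2 M : R, 0 < M & forall x, `|B x| <= M * `|x|.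
Proof.
move=> [M BM]; exists (`|M| + 1); first by rewrite ltr_wpDl.
move=> x; apply: (le_trans (BM x I)); rewrite ler_wpM2r//.
by rewrite (le_trans (ler_norm _))// lerDl.
Qed.

(** Boundedness of C: |C y|^2 = <B (C y), y> <= M |C y| |y|. *)
Lemma adjoint_pair_sym H1 H2 (B : H1 -> H2) C :
  adjoint_pair B C -> adjoint_pair C B.
Proof.
move=> [/bounded_posP[M M0 BM] BC]; split; last first.
  by move=> y x; rewrite innerC -BC innerC.
exists M => y _.
have [->|Cy0] := eqVneq (C y) 0; first by rewrite normr0 mulr_ge0// ltW.
rewrite -(@ler_pM2l _ `|C y|) ?normr_gt0// -expr2 -inner_norm -BC.
apply: (le_trans (ler_norm _)); apply: (le_trans (cauchy_schwarz _ _)).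
by rewrite mulrA ler_wpM2r// mulrC BM.
Qed.

Lemma adjoint_pair_comp H1 H2 (B : H1 -> H2) C :
  adjoint_pair B C -> adjoint_pair (C \o B) (C \o B).
Proof.
move=> BC; have CB := adjoint_pair_sym BC.
split; last by move=> x y /=; rewrite (adjoint_pairE CB) (adjoint_pairE BC).
have [M M0 BM] := bounded_posP (adjoint_pair_bounded BC).
have [N N0 CN] := bounded_posP (adjoint_pair_bounded CB).
exists (N * M) => x _ /=; apply: (le_trans (CN _)).
by rewrite -mulrA ler_wpM2l// ltW.
Qed.

Section Pair.
Context {H1 H2 : hilbertType R} {B : H1 -> H2} {C : H2 -> H1}.
Hypothesis BC : adjoint_pair B C.
Let CB : adjoint_pair C B := adjoint_pair_sym BC.

Lemma adjoint_pair_linear (a : R) x y : B (a *: x + y) = a *: B x + B y.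
Proof.
apply: inner_inj => z; rewrite innerDr innerZr -!(adjoint_pairE CB).
by rewrite innerDr innerZr.
Qed.

Lemma adjoint_pair0 : B 0 = 0.
Proof.
by apply: inner_inj => z; rewrite -(adjoint_pairE CB) !inner0r.
Qed.

Lemma adjoint_pairZ (a : R) x : B (a *: x) = a *: B x.
Proof. by rewrite -[a *: x]addr0 adjoint_pair_linear adjoint_pair0 addr0. Qed.

Lemma adjoint_pairB x y : B (x - y) = B x - B y.
Proof. by rewrite addrC -scaleN1r adjoint_pair_linear scaleN1r addrC. Qed.

Lemma ker_orthc_range : ker B = orthc (range C).
Proof.
apply/seteqP; split=> [x /= Bx _ [y _ <-]|x h].
  by rewrite -(adjoint_pairE BC) Bx inner0l.
apply: inner_inj => y; rewrite inner0r innerC (adjoint_pairE BC).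
by apply: h; exists y.
Qed.

Lemma range_sub_orthc_ker : range C `<=` orthc (ker B).
Proof.
by move=> _ [y _ <-] x /= Bx; rewrite (adjoint_pairE CB) Bx inner0r.
Qed.

Lemma subspace_range : subspace (range B).
Proof.
split=> [|a _ _ [x _ <-] [y _ <-]].
  by exists 0 => //; exact: adjoint_pair0.
by exists (a *: x + y) => //; rewrite adjoint_pair_linear.
Qed.

(** The projection of x on ker B, which is closed because it is an orthogonal
    complement, can be subtracted from x without changing B x. *)
Lemma orthc_ker_representative x : exists2 x', orthc (ker B) x' & B x' = B x.
Proof.
have [p kp xp] : exists2 p, ker B p & orthc (ker B) (x - p).
  rewrite ker_orthc_range; apply: orthogonal_projection.
    exact: subspace_orthc.
  exact: closed_orthc.
by exists (x - p) => //; rewrite adjoint_pairB (kp : B p = 0) subr0.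
Qed.

Lemma orthc_ker_inj : {in orthc (ker B) &, injective B}.
Proof.
move=> x y; rewrite !inE => kx ky Bxy; apply/eqP; rewrite -subr_eq0; apply/eqP.
apply: (@orthc_sub_eq0 _ _ (ker B)).
  by rewrite /ker/= adjoint_pairB Bxy subrr.
exact: (subspaceB (subspace_orthc _) kx ky).
Qed.

Lemma set_bij_orthc_ker : set_bij (orthc (ker B)) (range B) B.
Proof.
split; [by move=> x _; exists x | exact: orthc_ker_inj |].
move=> _ [x _ <-]; have [x' kx' Bx'] := orthc_ker_representative x.
by exists x'.
Qed.

End Pair.

(** (ker C)^perp is the double orthogonal complement of im B. *)
Lemma closed_rangeE H1 H2 (B : H1 -> H2) C : adjoint_pair B C ->
  closed (range B) <-> range B = orthc (ker C).
Proof.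
move=> BC; have CB := adjoint_pair_sym BC; split=> [clB|->].
  by rewrite (ker_orthc_range CB) orthcK//; exact: subspace_range BC.
exact: closed_orthc.
Qed.

(** Preimages in (ker B)^perp of points approaching y approach each other, by
    the lower bound; their limit is a preimage of y. *)
Lemma bounded_below_closed_range H1 H2 (B : H1 -> H2) C (c : R) :
  adjoint_pair B C -> 0 < c -> bounded_below B c -> closed (range B).
Proof.
move=> BC c0 Bc; apply/closed_approxP => y yB.
have [M M0 BM] := bounded_posP (adjoint_pair_bounded BC).
have [] := @shrinking_sets_cvg _ _
    (fun e x => orthc (ker B) x /\ `|y - B x| < e).
- by move=> d e x de [kx yx]; split=> //; exact: lt_le_trans de.
- move=> e e0; have [_ [x _ <-] yx] := yB e e0.
  by have [x' kx' Bx'] := orthc_ker_representative BC x; exists x'; rewrite Bx'.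
- move=> e e0; exists (c * e / 2); first by rewrite divr_gt0// mulr_gt0.
  move=> x z [kx yx] [kz yz].
  have kxz : orthc (ker B) (x - z).
    exact: (subspaceB (subspace_orthc _) kx kz).
  rewrite -(ltr_pM2l c0); apply: (le_lt_trans (Bc _ kxz)).
  rewrite (adjoint_pairB BC); have := ler_distD y (B x) (B z).
  rewrite (distrC (B x) y); lra.
move=> l lP; exists l => //; apply/esym/eqP.
rewrite -subr_eq0 -normr_le0; apply/ler_addgt0Pr => e e0; rewrite add0r.
have M1 : 0 < M + 1 by rewrite addr_gt0.
have [x [_ yx] xl] := lP _ (divr_gt0 e0 M1).
have BMxl := BM (x - l); rewrite (adjoint_pairB BC) in BMxl.
have := ler_distD (B x) y (B l).
have : `|B x - B l| < M * (e / (M + 1)).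
  by apply: (le_lt_trans BMxl); rewrite ltr_pM2l.
have : e = M * (e / (M + 1)) + e / (M + 1) by field; rewrite gt_eqF.
lra.
Qed.

(** Banach-Steinhaus applied to the functionals <-, y>, for y in im B with
    |C y| <= 1.  At z = B x + w with w orthogonal to im B, such a functional
    takes the value <x, C y>, of absolute value at most |x|.  A uniform bound
    M on the unit ball gives |y| <= M, and |y| <= M |C y| on im B by
    scaling. *)
Lemma closed_range_bounded_below H1 H2 (B : H1 -> H2) C :
  adjoint_pair B C -> closed (range B) ->
  exists2 c : R, 0 < c & bounded_below C c.
Proof.
move=> BC clB; have CB := adjoint_pair_sym BC.
have rB := (closed_rangeE BC).1 clB.
pose F := [set f : H2 -> R^o |
  exists y, [/\ range B y, `|C y| <= 1 & f = (fun z => inner z y)]].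
have [||M FM] := @Banach_Steinhauss R H2 R^o F _ _ 1.
- move=> _ [y [_ _ ->]]; split.
    move=> r; exists (r * `|y|) => z zr.
    by apply: (le_trans (cauchy_schwarz _ _)); rewrite ler_wpM2r.
  by move=> a u v; rewrite innerDl innerZl.
- move=> z; have [_ [x _ <-] zx] :=
    orthogonal_projection z (subspace_range BC) clB.
  exists `|x| => _ [y [By Cy ->]].
  have -> : inner z y = inner x (C y).
    by rewrite -(adjoint_pairE BC); apply/subr0_eq; rewrite -innerBl zx.
  by apply: (le_trans (cauchy_schwarz _ _)); rewrite ler_piMr.
have My y : range B y -> `|C y| <= 1 -> `|y| <= M.
  move=> By Cy.
  have [->|y0] := eqVneq y 0.
    rewrite normr0; have := FM (fun z => inner z 0) _ 0.
    rewrite inner0r !normr0; apply=> //; exists 0; split=> //.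
      exact: (subspace_range BC).1.
    by rewrite (adjoint_pair0 CB) normr0.
  have := FM (fun z => inner z y) _ (`|y|^-1 *: y).
  rewrite innerZl inner_norm normrM normrX !normr_id normfV normr_id expr2.
  rewrite mulKf ?normr_eq0//; apply; first by exists y.
  by rewrite normrZ normfV normr_id mulVf// normr_eq0.
have M1 : 0 < `|M| + 1 by rewrite ltr_wpDl.
exists (`|M| + 1)^-1; first by rewrite invr_gt0.
move=> y; rewrite -rB => By; rewrite mulrC ler_pdivrMr//.
have [Cy0|Cy0] := eqVneq (C y) 0.
  have -> : y = 0 by apply: (@orthc_sub_eq0 _ _ (ker C)) => //; rewrite -rB.
  by rewrite normr0 mulr_ge0// ltW.
have Cy : 0 < `|C y| by rewrite normr_gt0.
have Bs : range B (`|C y|^-1 *: y).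
  exact: (subspaceZ _ (subspace_range BC) By).
have := My _ Bs.
rewrite (adjoint_pairZ CB) !normrZ normfV normr_id mulVf ?gt_eqF//.
move=> /(_ (lexx _)); rewrite mulrC ler_pdivrMr// => /le_trans; apply.
by rewrite mulrC ler_wpM2l// (le_trans (ler_norm _))// lerDl.
Qed.

Lemma closed_range_adjoint H1 H2 (B : H1 -> H2) C :
  adjoint_pair B C -> closed (range B) -> closed (range C).
Proof.
move=> BC /(closed_range_bounded_below BC)[c c0 Cc].
exact: bounded_below_closed_range (adjoint_pair_sym BC) c0 Cc.
Qed.

Lemma sqr_norm_le_comp H1 H2 (B : H1 -> H2) C x :
  adjoint_pair B C -> `|B x| ^+ 2 <= `|x| * `|C (B x)|.
Proof.
move=> BC; rewrite -inner_norm (adjoint_pairE BC).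
exact: (le_trans (ler_norm _) (cauchy_schwarz _ _)).
Qed.

(** The range of B is closed, so a vector of (ker C)^perp = im B is B x with x
    in (ker B)^perp, and c |B x|^2 <= c |x| |C (B x)| <= |B x| |C (B x)|. *)
Lemma bounded_below_adjoint H1 H2 (B : H1 -> H2) C (c : R) :
  adjoint_pair B C -> 0 < c -> bounded_below B c -> bounded_below C c.
Proof.
move=> BC c0 Bc y.
have clB := bounded_below_closed_range BC c0 Bc.
rewrite -((closed_rangeE BC).1 clB) => -[x' _ <-].
have [x kx <-] := orthc_ker_representative BC x'.
have [->|Bx0] := eqVneq (B x) 0; first by rewrite normr0 mulr0.
have Bx : 0 < `|B x| by rewrite normr_gt0.
have h1 := sqr_norm_le_comp x BC.
have h2 := Bc _ kx.
rewrite -(ler_pM2l Bx).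
apply: (@le_trans _ _ (c * (`|x| * `|C (B x)|))).
  by rewrite mulrCA ler_pM2l// -expr2.
by rewrite mulrA ler_wpM2r.
Qed.

(** |B x|^2 = <x, C (B x)>. *)
Lemma ker_adjoint_comp H1 H2 (B : H1 -> H2) C :
  adjoint_pair B C -> ker (C \o B) = ker B.
Proof.
move=> BC; apply/seteqP; split=> x /= h; last first.
  by rewrite /ker/= (h : B x = 0) (adjoint_pair0 (adjoint_pair_sym BC)).
apply: inner_self_eq0.
by rewrite (adjoint_pairE BC) (h : C (B x) = 0) inner0r.
Qed.

Lemma bounded_below_comp H1 H2 (B : H1 -> H2) C (c : R) :
  adjoint_pair B C -> 0 < c -> bounded_below B c ->
  bounded_below (C \o B) (c ^+ 2).
Proof.
move=> BC c0 Bc x; rewrite (ker_adjoint_comp BC) => kx /=.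
have Cc := bounded_below_adjoint BC c0 Bc.
have kBx : orthc (ker C) (B x).
  by apply: (range_sub_orthc_ker (adjoint_pair_sym BC)); exists x.
apply: le_trans (Cc _ kBx); rewrite expr2 -mulrA.
by rewrite ler_pM2l// Bc.
Qed.

(** A lower bound of C B gives one of B because C is bounded; conversely
    lower bounds of B and C compose, since B maps into (ker C)^perp. *)
Lemma comp_closed_range H1 H2 (B : H1 -> H2) C :
  adjoint_pair B C -> closed (range (C \o B)) <-> closed (range B).
Proof.
move=> BC; have CB := adjoint_pair_sym BC.
have BB := adjoint_pair_comp BC.
split=> cl.
  have [c c0 Tc] := closed_range_bounded_below BB cl.
  have [M M0 CM] := bounded_posP (adjoint_pair_bounded CB).
  apply: (@bounded_below_closed_range _ _ _ _ (c / M) BC).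
    exact: divr_gt0.
  move=> x kx; rewrite mulrAC ler_pdivrMr// mulrC.
  rewrite -(ker_adjoint_comp BC) in kx.
  by rewrite mulrC [leRHS]mulrC; exact: le_trans (Tc _ kx) (CM _).
have clC := closed_range_adjoint BC cl.
have [c c0 Bc] := closed_range_bounded_below CB clC.
apply: (@bounded_below_closed_range _ _ _ _ (c ^+ 2) BB).
  exact: exprn_gt0.
exact: bounded_below_comp.
Qed.

(** It suffices to bound C below.  The range of C B, hence that of B, is
    closed, so a vector of (ker C)^perp is B x with x in
    (ker B)^perp = (ker (C B))^perp, and
    c |B x|^2 <= c |x| |C (B x)| <= |C (B x)|^2. *)
Lemma bounded_below_sqrt H1 H2 (B : H1 -> H2) C (c : R) :
  adjoint_pair B C -> 0 < c -> bounded_below (C \o B) c ->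
  bounded_below B (Num.sqrt c).
Proof.
move=> BC c0 Tc; have CB := adjoint_pair_sym BC.
have clT := bounded_below_closed_range (adjoint_pair_comp BC) c0 Tc.
have clB := (comp_closed_range BC).1 clT.
have s0 : 0 < Num.sqrt c by rewrite sqrtr_gt0.
apply: (bounded_below_adjoint CB s0) => y.
rewrite -((closed_rangeE BC).1 clB) => -[x' _ <-].
have [x kx <-] := orthc_ker_representative BC x'.
have h1 := sqr_norm_le_comp x BC.
have h2 : c * `|x| <= `|C (B x)|.
  by apply: Tc; rewrite (ker_adjoint_comp BC).
rewrite -(@ler_pXn2r _ 2)// ?nnegrE// ?mulr_ge0 ?sqrtr_ge0//.
rewrite exprMn sqr_sqrtr ?(ltW c0)//.
apply: (@le_trans _ _ (c * (`|x| * `|C (B x)|))); first by rewrite ler_pM2l.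
by rewrite mulrA expr2 ler_wpM2r.
Qed.

(** B takes all its values on (ker B)^perp = im C. *)
Lemma range_comp_adjoint H1 H2 (B : H1 -> H2) C :
  adjoint_pair B C -> closed (range C) -> range (B \o C) = range B.
Proof.
move=> BC clC; have CB := adjoint_pair_sym BC.
apply/seteqP; split=> [_ [y _ <-]|_ [x' _ <-]]; first by exists (C y).
have [x kx <-] := orthc_ker_representative BC x'.
move: kx; rewrite -((closed_rangeE CB).1 clC) => -[y _ <-].
by exists y.
Qed.

(** * Lower moduli *)

Lemma orthc_ker_neq0 H1 H2 (B : H1 -> H2) C :
  adjoint_pair B C -> B <> cst 0 ->
  exists x, [/\ orthc (ker B) x, x != 0 & B x != 0].
Proof.
move=> BC B0.
have [x' /eqP Bx'] : exists x, B x <> 0.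
  by apply/existsNP => h; apply: B0; apply/funext.
have [x kx Bx] := orthc_ker_representative BC x'.
rewrite -Bx in Bx'; exists x; split=> //.
by apply: contra_neq Bx' => ->; exact: adjoint_pair0 BC.
Qed.

(** The infimum defining |B| is over a nonempty set because B <> 0; without
    this its default value 0 would break the equivalence. *)
Lemma le_lower_modulus H1 H2 (B : H1 -> H2) C (c : R) :
  adjoint_pair B C -> B <> cst 0 -> c <= lower_modulus B <-> bounded_below B c.
Proof.
move=> BC B0; have lb : has_lbound
    [set `|B x| | x in [set x | orthc (ker B) x /\ `|x| = 1]].
  by exists 0 => _ [x _ <-].
have normalize x : x != 0 -> orthc (ker B) x ->
    [set x | orthc (ker B) x /\ `|x| = 1] (`|x|^-1 *: x).
  move=> x0 kx; split.
    exact: (subspaceZ _ (subspace_orthc _) kx).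
  by rewrite normrZ normfV normr_id mulVf// normr_eq0.
split=> [cB x kx|Bc].
  have [->|x0] := eqVneq x 0; first by rewrite normr0 mulr0.
  have nx : 0 < `|x| by rewrite normr_gt0.
  have : c <= `|B (`|x|^-1 *: x)|.
    apply: (le_trans cB); apply: ge_inf => //.
    by exists (`|x|^-1 *: x) => //; exact: normalize.
  by rewrite (adjoint_pairZ BC) normrZ normfV normr_id ler_pdivlMl// mulrC.
have [x0 [kx0 x00 _]] := orthc_ker_neq0 BC B0.
apply: lb_le_inf.
  by exists `|B (`|x0|^-1 *: x0)|, (`|x0|^-1 *: x0) => //; exact: normalize.
by move=> _ [x [kx x1] <-]; have := Bc _ kx; rewrite x1 mulr1.
Qed.

Lemma lower_modulus_gt0P H1 H2 (B : H1 -> H2) C :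
  adjoint_pair B C -> B <> cst 0 ->
  0 < lower_modulus B <-> closed (range B).
Proof.
move=> BC B0; have CB := adjoint_pair_sym BC; split=> [m0|clB].
  apply: (bounded_below_closed_range BC m0).
  exact/(le_lower_modulus _ BC B0).
have clC := closed_range_adjoint BC clB.
have [c c0 /(le_lower_modulus _ BC B0)] :=
  closed_range_bounded_below CB clC.
exact: lt_le_trans.
Qed.

Lemma adjoint_pair_neq0 H1 H2 (B : H1 -> H2) C :
  adjoint_pair B C -> B <> cst 0 -> C <> cst 0.
Proof.
move=> BC + C0; apply; apply/funext => x.
by apply: inner_inj => y; rewrite innerC (adjoint_pairE BC) C0 !inner0r.
Qed.

Lemma comp_adjoint_neq0 H1 H2 (B : H1 -> H2) C :
  adjoint_pair B C -> B <> cst 0 -> C \o B <> cst 0.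
Proof.
move=> BC + T0; apply; apply/funext => x.
suff : ker B x by [].
by rewrite -(ker_adjoint_comp BC) T0.
Qed.

Lemma lower_modulus_adjoint H1 H2 (B : H1 -> H2) C :
  adjoint_pair B C -> B <> cst 0 -> closed (range B) ->
  lower_modulus B = lower_modulus C.
Proof.
move=> BC B0 clB; have CB := adjoint_pair_sym BC.
have C0 := adjoint_pair_neq0 BC B0.
have clC := closed_range_adjoint BC clB.
have mB := (lower_modulus_gt0P BC B0).2 clB.
have mC := (lower_modulus_gt0P CB C0).2 clC.
apply/le_anti/andP; split.
  apply/(le_lower_modulus _ CB C0).
  apply: (bounded_below_adjoint BC mB).
  exact/(le_lower_modulus _ BC B0).
apply/(le_lower_modulus _ BC B0).
apply: (bounded_below_adjoint CB mC).
exact/(le_lower_modulus _ CB C0).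
Qed.

Lemma lower_modulus_comp H1 H2 (B : H1 -> H2) C :
  adjoint_pair B C -> B <> cst 0 -> closed (range B) ->
  Num.sqrt (lower_modulus (C \o B)) = lower_modulus B.
Proof.
move=> BC B0 clB; have BB := adjoint_pair_comp BC.
have T0 := comp_adjoint_neq0 BC B0.
have clT := (comp_closed_range BC).2 clB.
have mB := (lower_modulus_gt0P BC B0).2 clB.
have mT := (lower_modulus_gt0P BB T0).2 clT.
apply/le_anti/andP; split.
  apply/(le_lower_modulus _ BC B0).
  apply: (bounded_below_sqrt BC mT).
  exact/(le_lower_modulus _ BB T0).
rewrite -[leLHS](gtr0_norm mB) -sqrtr_sqr.
rewrite ler_psqrt ?nnegrE ?(ltW mT) ?sqr_ge0//.
apply/(le_lower_modulus _ BB T0).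
apply: (bounded_below_comp BC mB).
exact/(le_lower_modulus _ BC B0).
Qed.

(** * The inverse of the restriction to the orthogonal complement *)

Lemma sharp_invP H1 H2 (B : H1 -> H2) C y : adjoint_pair B C -> range B y ->
  orthc (ker B) (sharp_inv B y) /\ B (sharp_inv B y) = y.
Proof.
move=> BC By; have [_ _ surj] := set_bij_orthc_ker BC; split.
  have := @surjpinv_image_sub _ _ (fun=> 0) _ _ _ surj (sharp_inv B y).
  by apply; exists y.
have /(_ y) := @surjpK _ _ (fun=> 0) _ _ _ surj.
by rewrite inE; exact.
Qed.

Lemma sharp_invK H1 H2 (B : H1 -> H2) C x : adjoint_pair B C ->
  orthc (ker B) x -> sharp_inv B (B x) = x.
Proof.
move=> BC kx; have [_ inj _] := set_bij_orthc_ker BC.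
by apply: pinvKV => //; rewrite inE.
Qed.

Lemma sharp_inv_le H1 H2 (B : H1 -> H2) C (c : R) : adjoint_pair B C ->
  0 < c -> bounded_below B c ->
  forall y, range B y -> `|sharp_inv B y| <= c^-1 * `|y|.
Proof.
move=> BC c0 Bc y By; have [ks Bs] := sharp_invP BC By.
by rewrite -[in leRHS]Bs ler_pdivlMl// Bc.
Qed.

(** M bounds the inverse of B^# on the unit ball of im B exactly when
    |z| / |B z| <= M for all nonzero z in (ker B)^perp, that is, when B is
    bounded below by 1 / M. *)
Lemma opnorm_sharp_inv H1 H2 (B : H1 -> H2) C :
  adjoint_pair B C -> B <> cst 0 -> closed (range B) ->
  opnorm_on (range B) (sharp_inv B) = (lower_modulus B)^-1.
Proof.
move=> BC B0 clB; have mB := (lower_modulus_gt0P BC B0).2 clB.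
have Bm : bounded_below B (lower_modulus B).
  exact/(le_lower_modulus _ BC B0).
set D := [set `|sharp_inv B x| | x in [set x | range B x /\ `|x| <= 1]].
have ubD : ubound D (lower_modulus B)^-1.
  move=> _ [y [By y1] <-].
  apply: (le_trans (sharp_inv_le BC mB Bm By)).
  by rewrite ler_piMr// invr_ge0 ltW.
have normalized x : orthc (ker B) x -> B x != 0 -> D (`|x| / `|B x|).
  move=> kx Bx0; exists (`|B x|^-1 *: B x).
    split; last by rewrite normrZ normfV normr_id mulVf// normr_eq0.
    by exists (`|B x|^-1 *: x) => //; rewrite (adjoint_pairZ BC).
  rewrite -(adjoint_pairZ BC) (sharp_invK BC).
    by rewrite normrZ normfV normr_id mulrC.
  exact: (subspaceZ _ (subspace_orthc _) kx).
have [x [kx x0 Bx0]] := orthc_ker_neq0 BC B0.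
have Dx := normalized _ kx Bx0.
have supD : has_sup D.
  by split; [exists (`|x| / `|B x|) | exists (lower_modulus B)^-1].
rewrite /opnorm_on -/D; apply/le_anti/andP; split.
  exact: sup_le_ub supD.1 ubD.
have sD : 0 < sup D.
  apply: (lt_le_trans _ (ub_le_sup supD.2 Dx)).
  by rewrite divr_gt0// normr_gt0.
rewrite -[leRHS]invrK lef_pV2 ?posrE ?invr_gt0//.
apply/(le_lower_modulus _ BC B0) => z kz.
have [Bz0|Bz0] := eqVneq (B z) 0.
  by rewrite (@orthc_sub_eq0 _ _ (ker B) z Bz0 kz) normr0 mulr0.
have Bz : 0 < `|B z| by rewrite normr_gt0.
rewrite ler_pdivrMl// -ler_pdivrMr//.
exact: (ub_le_sup supD.2 (normalized _ kz Bz0)).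
Qed.

(** * The adjoint of a bounded operator *)

Lemma adjoint_pair_adjoint H1 H2 (A : {linear H1 -> H2}) :
  bounded_on setT A -> adjoint_pair A (adjoint A).
Proof.
move=> Ab; split=> // x y; have [M M0 AM] := bounded_posP Ab.
have [z zP] : exists z, forall x, inner (A x) y = inner x z.
  apply: (@riesz_representation _ _ (fun x => inner (A x) y) (M * `|y|)).
    by move=> a u v; rewrite linearP innerDl innerZl.
  move=> u; apply: (le_trans (cauchy_schwarz _ _)).
  by rewrite mulrAC ler_wpM2r.
have : [set z | forall x, inner (A x) y = inner x z] (adjoint A y).
  by apply: xgetI zP.
exact.
Qed.

End AdjointPair.

Theorem lemma3p2 (R : realType) (H1 H2 : hilbertType R) (A : {linear H1 -> H2})
    (A_bounded : bounded_on setT A) (A_neq0 : (A : H1 -> H2) <> cst 0) :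
  let A' : H2 -> H1 := adjoint A in
  [/\ [<-> closed (range A);
           range A = orthc (ker A');
           0 < lower_modulus A;
           closed (range A');
           range A' = orthc (ker A);
           0 < lower_modulus A';
           closed (range (A \o A'));
           range (A \o A') = orthc (ker (A \o A'));
           0 < lower_modulus (A \o A');
           closed (range (A' \o A));
           range (A' \o A) = orthc (ker (A' \o A));
           0 < lower_modulus (A' \o A)]
    & (closed (range A) \/
       range A = orthc (ker A') \/
       0 < lower_modulus A \/
       closed (range A') \/
       range A' = orthc (ker A) \/
       0 < lower_modulus A' \/
       closed (range (A \o A')) \/
       range (A \o A') = orthc (ker (A \o A')) \/
       0 < lower_modulus (A \o A') \/
       closed (range (A' \o A)) \/
       range (A' \o A) = orthc (ker (A' \o A)) \/
       0 < lower_modulus (A' \o A)) ->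
      (range (A \o A') = range A /\ range (A' \o A) = range A') /\
      (set_bij (orthc (ker A)) (range A) A /\
       bounded_on (range A) (sharp_inv A)) /\
      [/\ lower_modulus A = lower_modulus A',
          lower_modulus A' = Num.sqrt (lower_modulus (A \o A')),
          Num.sqrt (lower_modulus (A \o A')) =
            Num.sqrt (lower_modulus (A' \o A))
        & Num.sqrt (lower_modulus (A' \o A)) =
            1 / opnorm_on (range A) (sharp_inv A)]].
Proof.
move=> A'.
have AA' : adjoint_pair A A' by exact: adjoint_pair_adjoint.
have A'A := adjoint_pair_sym AA'.
have TA := adjoint_pair_comp AA'.
have TA' := adjoint_pair_comp A'A.
have A'0 := adjoint_pair_neq0 AA' A_neq0.
(* Each of the twelve conditions is equivalent to an earlier one, and so in the
   end to closedness of im A. *)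
have e2 := closed_rangeE AA'.
have e3 := lower_modulus_gt0P AA' A_neq0.
have e4 : closed (range A') <-> closed (range A).
  by split; [exact: closed_range_adjoint A'A | exact: closed_range_adjoint AA'].
have e5 := closed_rangeE A'A.
have e6 := lower_modulus_gt0P A'A A'0.
have e7 := comp_closed_range A'A.
have e8 := closed_rangeE TA'.
have e9 := lower_modulus_gt0P TA' (comp_adjoint_neq0 A'A A'0).
have e10 := comp_closed_range AA'.
have e11 := closed_rangeE TA.
have e12 := lower_modulus_gt0P TA (comp_adjoint_neq0 AA' A_neq0).
split; first by tfae; tauto.
move=> some.
have clA : closed (range A) by tauto.
have clA' := e4.2 clA.
have mA : 0 < lower_modulus A by exact/e3.
split.
  split; first exact: range_comp_adjoint AA' clA'.
  exact: range_comp_adjoint A'A clA.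
split.
  split; first exact: set_bij_orthc_ker AA'.
  exists (lower_modulus A)^-1; apply: (sharp_inv_le AA' mA).
  exact/(le_lower_modulus _ AA' A_neq0).
have mE := lower_modulus_adjoint AA' A_neq0 clA.
have sE := lower_modulus_comp AA' A_neq0 clA.
have sE' := lower_modulus_comp A'A A'0 clA'.
split; rewrite ?sE ?sE'//.
by rewrite (opnorm_sharp_inv AA' A_neq0 clA) div1r invrK.
Qed.
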